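(* If $k, l$ are integers with $k \geq 5$ and $l \geq 1$, then $\operatorname{sg}(K_{1, k} \,\square\, P_l) = \operatorname{sg}(K_{1, k})$.
   Context: All graphs are finite, simple and connected. $K_{1,k}$ is the star with $k$ leaves and $P_l$ is the path on $l$ vertices. Strong geodetic number: given $S\subseteq V(G)$, for each pair of distinct vertices $x,y\in S$ (unordered pair) select one fixed shortest $x,y$-path $\widetilde g(x,y)$. If for some such selection every vertex of $G$ lies on at least one of the selected paths, then $S$ is called a strong geodetic set of $G$. For a one-vertex graph, its vertex forms the unique strong geodetic set. The strong geodetic number $\operatorname{sg}(G)$ is the minimum cardinality of a strong geodetic set of $G$. The Cartesian product $G\,\square\,H$ has vertex set $V(G)\times V(H)$, with $(g,h)$ adjacent to $(g',h')$ iff either $g=g'$ and $hh'\in E(H)$, or $h=h'$ and $gg'\in E(G)$. *)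

(* Defs.v *)
(* MathComp, with the classical layer of MathComp-Analysis (boolp) used only to
   decide the Prop-valued notion of strong geodetic set. *)
From mathcomp Require Import all_boot.
From mathcomp Require Import boolp.

Set Implicit Arguments.
Unset Strict Implicit.
Unset Printing Implicit Defensive.

(* Finite simple connected graphs. *)
Record graph := Graph {
  vertex :> finType;
  adj : rel vertex;
  adj_sym : symmetric adj;
  adj_irrefl : irreflexive adj;
  adj_connected : forall x y, connect adj x y }.

(* [s] is the list of all the vertices of the path, both endpoints included. *)
Definition is_path (G : graph) (x y : G) (s : seq G) : bool :=
  if s is z :: p then [&& z == x, path (@adj G) x p, last x p == y & uniq s]
  else false.

Definition shortest_path (G : graph) (x y : G) (s : seq G) : Prop :=
  is_path x y s /\ forall t, is_path x y t -> size s <= size t.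

(* [g] selects one path per unordered pair: [g y x] is [g x y] read backwards. *)
Definition path_selection (G : graph) (S : {set G}) (g : G -> G -> seq G) :=
  forall x y, x \in S -> y \in S -> x != y ->
    shortest_path x y (g x y) /\ g y x = rev (g x y).

(* The first disjunct is the convention for one-vertex graphs, where there is
   no pair of distinct vertices. *)
Definition strong_geodetic (G : graph) (S : {set G}) : Prop :=
  (#|G| = 1 /\ S = setT) \/
  exists2 g, path_selection S g &
    forall v, exists x y, [/\ x \in S, y \in S, x != y & v \in g x y].

(* The default [setT] of the argmin is always strong geodetic; see [sg_le] and
   [sg_attained]. *)
Definition sg (G : graph) : nat :=
  #|[arg min_(S < [set: G] | `[< strong_geodetic S >]) #|S| ]|.

Section StrongGeodeticNumber.
Variable G : graph.
Implicit Types (x y : G) (S : {set G}).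

Lemma is_path_rev x y s : is_path x y s -> is_path y x (rev s).
Proof.
case: s => //= z p /and4P[/eqP-> pp /eqP lp up].
have rE : rev (x :: p) = y :: rev (belast x p).
  by rewrite lastI rev_rcons lp.
have := up; rewrite -[_ && _]/(uniq (x :: p)) -rev_uniq rE /= eqxx => -> /=.
rewrite andbT; apply/andP; split.
  rewrite -lp rev_path (eq_path (e' := @adj G)) // => a b; exact: adj_sym.
have : last x (rev (x :: p)) = x by rewrite rev_cons last_rcons.
by rewrite rE /= => ->.
Qed.

Lemma shortest_path_rev x y s :
  shortest_path x y s -> shortest_path y x (rev s).
Proof.
case=> ps ms; split; first exact: is_path_rev.
by move=> t /is_path_rev/ms; rewrite !size_rev.
Qed.

Lemma shortest_path_exists x y : exists s, shortest_path x y s.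
Proof.
have [p pp lp] := connectP (adj_connected x y).
have exP : exists n, `[< exists2 s, is_path x y s & size s = n >].
  case/shortenP: pp lp => p' pp' up' _ lp'.
  exists (size p').+1; apply/asboolP; exists (x :: p') => //.
  by rewrite /is_path eqxx pp' -lp' eqxx up'.
case: (ex_minnP exP) => n /asboolP[s ps sn] mn.
exists s; split=> // t pt; rewrite sn; apply: mn.
by apply/asboolP; exists t.
Qed.

Lemma strong_geodetic_setT : @strong_geodetic G setT.
Proof.
have [G1|G1] := eqVneq #|G| 1; first by left.
right.
have /choice[c cP] : forall xy : G * G, exists s, shortest_path xy.1 xy.2 s.
  by move=> xy; apply: shortest_path_exists.
pose g x y := if enum_rank x < enum_rank y then c (x, y) else rev (c (y, x)).
have gP x y : shortest_path x y (g x y).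
  rewrite /g; case: ifP => _; first exact: (cP (x, y)).
  by apply: shortest_path_rev; apply: (cP (y, x)).
exists g => [x y _ _ xy|v].
  split=> //; rewrite /g; case: ltngtP => //; first by rewrite revK.
  by move=> /ord_inj/enum_rank_inj exy; rewrite exy eqxx in xy.
have /card_gt0P[y] : 0 < #|[set~ v]|.
  rewrite cardsC1 -subn1 subn_gt0 ltn_neqAle eq_sym G1.
  by apply/card_gt0P; exists v.
rewrite !inE => yv; exists v, y; rewrite !inE eq_sym yv; split=> //.
case: (gP v y) => + _; case: (g v y) => //= z p /and4P[/eqP-> _ _ _].
exact: mem_head.
Qed.

Lemma sg_le S : strong_geodetic S -> sg G <= #|S|.
Proof.
move=> SS; rewrite /sg; case: arg_minnP => [|A _ mA].
  exact/asboolP/strong_geodetic_setT.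
exact/mA/asboolP.
Qed.

Lemma sg_attained : exists2 S : {set G}, strong_geodetic S & #|S| = sg G.
Proof.
rewrite /sg; case: arg_minnP => [|A /asboolP AS _].
  exact/asboolP/strong_geodetic_setT.
by exists A.
Qed.

End StrongGeodeticNumber.

Section Star.
Variable k : nat.

(* The centre is [None]. *)
Definition star_adj : rel (option 'I_k) :=
  fun x y => (x == None) (+) (y == None).

Fact star_adj_sym : symmetric star_adj.
Proof. by move=> x y; rewrite /star_adj addbC. Qed.

Fact star_adj_irrefl : irreflexive star_adj.
Proof. by move=> x; rewrite /star_adj addbb. Qed.

Fact star_adj_connected x y : connect star_adj x y.
Proof.
have cN z : connect star_adj z None.
  by case: z => [i|]; [apply: connect1 | apply: connect0].
apply: (connect_trans (cN x)).
by rewrite (sym_connect_sym star_adj_sym).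
Qed.

Definition star : graph :=
  Graph star_adj_sym star_adj_irrefl star_adj_connected.

End Star.

Section PathGraph.
Variable l : nat.

Definition path_adj : rel 'I_l := fun i j => (i.+1 == j) || (j.+1 == i).

Fact path_adj_sym : symmetric path_adj.
Proof. by move=> i j; rewrite /path_adj orbC. Qed.

Fact path_adj_irrefl : irreflexive path_adj.
Proof. by move=> i; rewrite /path_adj orbb gtn_eqF. Qed.

Fact path_adj_connected i j : connect path_adj i j.
Proof.
have up (a b : 'I_l) : a <= b -> connect path_adj a b.
  case: b => b; elim: b => [|b IHb] bl /= ab.
    by rewrite (_ : a = Ordinal bl) ?connect0 //; apply/val_inj/eqP; rewrite -leqn0.
  move: ab; rewrite leq_eqVlt => /predU1P[ab|ab].
    by rewrite (_ : a = Ordinal bl) ?connect0 //; apply: val_inj.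
  apply: connect_trans (IHb (ltnW bl) ab) (connect1 _).
  by rewrite /path_adj /= eqxx.
have [/up //|/ltnW/up] := leqP i j.
by rewrite (sym_connect_sym path_adj_sym).
Qed.

Definition path_graph : graph :=
  Graph path_adj_sym path_adj_irrefl path_adj_connected.

End PathGraph.

Section CartesianProduct.
Variables G H : graph.

Definition cart_adj : rel (G * H) := fun u v =>
  (u.1 == v.1) && adj u.2 v.2 || (u.2 == v.2) && adj u.1 v.1.

Fact cart_adj_sym : symmetric cart_adj.
Proof.
move=> u v; rewrite /cart_adj (eq_sym u.1) (eq_sym u.2).
by rewrite (adj_sym u.1) (adj_sym u.2).
Qed.

Fact cart_adj_irrefl : irreflexive cart_adj.
Proof. by move=> u; rewrite /cart_adj !adj_irrefl !andbF. Qed.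

Fact cart_adj_connected u v : connect cart_adj u v.
Proof.
case: u v => [g h] [g' h']; apply: (@connect_trans _ _ (g', h)).
  have /connectP[p pp ->] := adj_connected g g'.
  apply/connectP; exists [seq (x, h) | x <- p]; last by rewrite (last_map (fun x => (x, h))).
  rewrite path_map; apply: sub_path pp => x y xy.
  by rewrite /= /cart_adj /= eqxx xy orbT.
have /connectP[p pp ->] := adj_connected h h'.
apply/connectP; exists [seq (g', x) | x <- p]; last by rewrite (last_map (pair g')).
rewrite path_map; apply: sub_path pp => x y xy.
by rewrite /= /cart_adj /= eqxx xy.
Qed.

Definition cart_prod : graph :=
  Graph cart_adj_sym cart_adj_irrefl cart_adj_connected.

End CartesianProduct.

(* Main.v *)
(** The map pushing one leaf fibre [{i} x P_l] onto the central fibre is a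
    folding: it shortens every path that enters the fibre from outside and
    leaves it again.  So a strong geodetic set meets each of the [k] leaf fibres
    (and, for [l = 1], contains each leaf of the star).

    Conversely, put one end of each leaf fibre in [S]: the bottom for the leaves
    0 and 1, the top for the others.  A geodesic from a bottom end to a top end
    may climb inside either of its two leaf fibres or inside the central one, and
    thereby covers that fibre.  The pairs (0,2), (1,2), (1,3), (0,3) cover the
    fibres of 0, 2, 1, 3, the pairs (0,j) those of the j >= 4, and the pair (1,4),
    available because [k >= 5], covers the central fibre. *)
Require Import Defs.
From mathcomp Require Import all_boot.

Set Implicit Arguments.
Unset Strict Implicit.
Unset Printing Implicit Defensive.

(** * Certificates for geodesics, and folding maps *)

Section Graphs.
Variable G : graph.
Implicit Types (x y u v : G) (p s t : seq G) (S : {set G}).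

(** Walks shorten to paths, so a geodesic is minimal among walks too; folding a path yields only a
    walk. *)
Lemma shortest_path_walk x y s p :
  shortest_path x y s -> path (@adj G) x p -> last x p = y ->
  size s <= (size p).+1.
Proof.
case=> _ min_s /shortenP[q pq uq sub_q] lq.
apply: leq_trans (min_s (x :: q) _) _; first by rewrite /= eqxx pq lq eqxx.
by apply: uniq_leq_size sub_q; case/andP: uq.
Qed.

Lemma lipschitz_path (phi : G -> nat) x p :
  (forall u v, adj u v -> phi v <= (phi u).+1) ->
  path (@adj G) x p -> phi (last x p) <= phi x + size p.
Proof.
move=> lip; elim: p x => [|y p IHp] x /=; first by rewrite addn0.
case/andP=> /lip xy /IHp /leq_trans; apply.
by rewrite addnS -addSn leq_add2r.
Qed.

(** Each step raises [phi] by at most one, so its total rise bounds the length of any competing path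
    from below; [size] counts vertices, hence the successor. *)
Lemma shortest_path_lipschitz (phi : G -> nat) x y s :
  (forall u v, adj u v -> phi v <= (phi u).+1) ->
  is_path x y s -> phi x + size s <= (phi y).+1 -> shortest_path x y s.
Proof.
move=> lip ps le_s; split=> // -[|z t] //= /and4P[/eqP-> pt /eqP lt _].
have := lipschitz_path lip pt; rewrite lt -ltnS -addnS => /(leq_trans le_s).
by rewrite leq_add2l.
Qed.

Section Folding.
Variable r : G -> G.
Hypothesis r_weak_hom : forall u v, adj u v -> r u = r v \/ adj (r u) (r v).
Hypothesis r_fold : forall u v, adj u v -> r u = u -> r v <> v -> r v = u.

(** Apply [r] vertexwise and drop repetitions. The first vertex moved by [r] goes to its fixed
    predecessor by [r_fold], so a step is lost. *)
Lemma folded_walk x p : path (@adj G) x p ->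
  exists q, [/\ path (@adj G) (r x) q, last (r x) q = r (last x p),
    size q <= size p &
    r x = x -> has (fun v => r v != v) p -> size q < size p].
Proof.
elim: p x => [|y p IHp] x /=; first by exists [::].
case/andP=> xy /IHp[q [pq lq le_qp lt_qp]].
have [rxy|rxy] := r_weak_hom xy.
  by exists q; rewrite rxy; split=> //; apply: leqW.
exists (r y :: q) => /=; rewrite rxy; split=> // rx.
case: eqP => [ry /= /(lt_qp ry)//|/(r_fold xy rx) ry _].
by rewrite ry rx adj_irrefl in rxy.
Qed.

(** Otherwise the folded walk would join the same ends in fewer steps. *)
Lemma shortest_path_fixed x y s : shortest_path x y s -> r x = x -> r y = y ->
  forall v, v \in s -> r v = v.
Proof.
case: s => [|z p]; first by case.
move=> sp rx ry; have := sp; case=> /and4P[/eqP zx pp /eqP lp _] _.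
rewrite {z}zx in sp *.
have [q [pq lq _ lt_qp]] := folded_walk pp.
move=> v; rewrite inE => /predU1P[->//|vp]; apply/eqP/negPn/negP => rv.
rewrite rx in pq lq; rewrite lp ry in lq.
have := shortest_path_walk sp pq lq; rewrite ltnS leqNgt lt_qp //.
by apply/hasP; exists v.
Qed.

Lemma strong_geodetic_unfixed S v : strong_geodetic S -> r v <> v ->
  exists2 x, x \in S & r x <> x.
Proof.
case=> [[_ ->] rv|[g gP cov] rv]; first by exists v; rewrite ?inE.
have [x [y [xS yS xy vg]]] := cov v.
have [rx|/eqP rx] := eqVneq (r x) x; last by exists x.
have [ry|/eqP ry] := eqVneq (r y) y; last by exists y.
have [sp _] := gP x y xS yS xy.
by case: rv; apply: (shortest_path_fixed sp).
Qed.

End Folding.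

(** The tournament [e] orients each pair, so one geodesic per pair suffices; reversal supplies the
    other. *)
Lemma path_selection_rel (e : rel G) (f : G -> G -> seq G) S :
  {in S &, forall x y, x != y -> e y x = ~~ e x y} ->
  {in S &, forall x y, e x y -> shortest_path x y (f x y)} ->
  path_selection S (fun x y => if e x y then f x y else rev (f y x)).
Proof.
move=> e_anti fP x y xS yS xy; rewrite (e_anti x y) //.
case: (boolP (e x y)) => exy /=; first by split=> //; apply: fP.
rewrite revK; split=> //; apply: shortest_path_rev; apply: fP => //.
by rewrite (e_anti x y).
Qed.

End Graphs.

(* [pr] is the projection of [G] to the star and [c] sends each vertex to the
   vertex above the centre to which its leaf fibre is folded. *)
Lemma leaf_fibres_card (G : graph) (k : nat) (pr : G -> option 'I_k)
    (c : G -> G) (leaf : 'I_k -> G) (S : {set G}) :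
  (forall i, pr (leaf i) = Some i) ->
  (forall v, pr (c v) = None) ->
  (forall u v i, adj u v -> pr v = Some i -> pr u != Some i -> c v = u) ->
  (forall u v, adj u v -> pr u = pr v -> c u = c v \/ adj (c u) (c v)) ->
  strong_geodetic S -> k <= #|S|.
Proof.
move=> pr_leaf pr_c c_fold c_hom SS.
suff sub : [set Some i | i : 'I_k] \subset pr @: S.
  rewrite -[k]card_ord -(card_imset predT (@Some_inj _)).
  exact: leq_trans (subset_leq_card sub) (leq_imset_card _ _).
apply/subsetP => _ /imsetP[i _ ->].
(* Only the fibre over [i] is folded, so an element of [S] moved by [r] must lie in it. *)
pose r v := if pr v == Some i then c v else v.
have r_fix v : r v <> v -> pr v = Some i by rewrite /r; case: eqP.
have [||||x xS /r_fix prx] := @strong_geodetic_unfixed G r _ _ S (leaf i).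
- move=> u v uv; rewrite /r; case: eqP => [pu|/eqP pu]; case: eqP => [pv|/eqP pv].
  + by apply: c_hom; rewrite ?pu ?pv.
  + by left; apply: c_fold pu pv; rewrite adj_sym.
  + by left; rewrite (c_fold u v i).
  + by right.
- move=> u v uv ru rv; have pv := r_fix v rv; rewrite /r pv eqxx.
  apply: c_fold uv pv _; apply/eqP => pu.
  by have := pr_c u; move: ru; rewrite /r pu eqxx => ->; rewrite pu.
- by [].
- rewrite /r pr_leaf eqxx => cl; by have := pr_c (leaf i); rewrite cl pr_leaf.
by apply/imsetP; exists x.
Qed.

(** * The strong geodetic number of the star *)

Section Star.
Variable k : nat.
Notation K := (star k).

Lemma leaf_eq (i j : 'I_k) : (Some i == Some j :> K) = (i == j).
Proof. exact: (inj_eq Some_inj). Qed.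

(** Two minus the distance to the leaf [j]. *)
Definition leaf_height (j : 'I_k) (w : K) : nat :=
  if w == Some j then 2 else w == None.

Lemma leaf_height_lip j u v :
  adj u v -> leaf_height j v <= (leaf_height j u).+1.
Proof.
rewrite /= /star_adj /leaf_height.
by case: u v => [a|] [b|] //= _; case: ifP.
Qed.

Lemma star_shortest (i j : 'I_k) : i != j ->
  @shortest_path K (Some i) (Some j) [:: Some i; None; Some j].
Proof.
move=> ij; apply: (shortest_path_lipschitz (@leaf_height_lip j)).
  by rewrite /= !eqxx !inE /= leaf_eq ij.
by rewrite /leaf_height eqxx leaf_eq (negPf ij).
Qed.

Lemma star_strong_geodetic : 1 < k ->
  @strong_geodetic K [set Some i | i : 'I_k].
Proof.
move=> k2; right; exists (fun x y => [:: x; None; y]).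
  move=> _ _ /imsetP[i _ ->] /imsetP[j _ ->]; rewrite leaf_eq => ij.
  by split=> //; apply: star_shortest.
have leafS (i : 'I_k) : Some i \in [set Some i | i : 'I_k].
  by apply/imsetP; exists i.
pose i0 := Ordinal (ltnW k2); pose i1 := Ordinal k2.
case=> [i|]; last by exists (Some i0), (Some i1); rewrite !leafS !inE.
have [->|ii0] := eqVneq i i0.
  by exists (Some i0), (Some i1); rewrite !leafS !inE.
by exists (Some i), (Some i0); rewrite !leafS !inE leaf_eq ii0 eqxx.
Qed.

Lemma sg_star : 1 < k -> sg K = k.
Proof.
move=> k2; apply/eqP; rewrite eqn_leq; apply/andP; split.
  apply: leq_trans (sg_le (star_strong_geodetic k2)) _.
  by rewrite card_imset ?card_ord //; apply: Some_inj.
have [S SS <-] := sg_attained K.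
apply: (@leaf_fibres_card K k id (fun=> None) Some) SS => //.
- by move=> [a|] [b|] i.
- by left.
Qed.

End Star.

(** * The product of the star with a path *)

Section StarPath.
Variables k l : nat.
Notation G := (cart_prod (star k) (path_graph l.+1)).
Implicit Types (w : star k) (u v : G) (i j : 'I_k) (h : 'I_l.+1).

Lemma starpath_lower (S : {set G}) : strong_geodetic S -> k <= #|S|.
Proof.
apply: (@leaf_fibres_card G k fst (fun v => (None, v.2))
  (fun i => (Some i, ord0))) => //.
- move=> [a h] [b h'] i /= uv /= b_i a_i; subst b.
  move: uv; rewrite /= /cart_adj /= (negPf a_i) /= => /andP[/eqP<-].
  by case: a {a_i}.
- move=> [a h] [b h'] /= uv /= ab; move: uv; rewrite /cart_adj ab /=.
  rewrite star_adj_irrefl andbF orbF eqxx /= => hh; right.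
  by rewrite /cart_adj /= hh.
Qed.

(** The bottom is left out because [path] takes its start separately. *)
Definition climb w : seq G := [seq (w, h) | h <- behead (enum 'I_l.+1)].

Lemma climbE w :
  ((w, ord0) : G) :: climb w = [seq (w, h) | h <- enum 'I_l.+1].
Proof. by rewrite /climb enum_ordSl. Qed.

Lemma mem_climb w v : (v \in (w, ord0) :: climb w) = (v.1 == w).
Proof.
rewrite climbE; case: v => a h /=; apply/mapP/eqP => [[h' _ [-> _]]//|->].
by exists h; rewrite ?mem_enum.
Qed.

Lemma climb_path w : path (@adj G) (w, ord0) (climb w).
Proof.
rewrite -[path _ _ _]/(sorted (@adj G) ((w, ord0) :: climb w)) climbE.
rewrite sorted_map.
have : sorted (fun m n => m.+1 == n) (iota 0 l.+1).
  by rewrite /=; elim: l 0 => //= n IHn m; rewrite eqxx IHn.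
rewrite -val_enum_ord sorted_map; apply: sub_sorted => a b /= ab.
by rewrite /cart_adj /= eqxx /path_adj ab.
Qed.

Lemma climb_last w : last ((w, ord0) : G) (climb w) = (w, ord_max).
Proof.
rewrite -[LHS]/(last ((w, ord0) : G) ((w, ord0) :: climb w)) climbE.
by rewrite enum_ordSr map_rcons last_rcons.
Qed.

Lemma climb_size w : size (climb w) = l.
Proof. by rewrite size_map size_behead size_enum_ord. Qed.

Lemma climb_uniq w : uniq (((w, ord0) : G) :: climb w).
Proof. by rewrite climbE map_inj_uniq ?enum_uniq // => a b []. Qed.

(** Equals [l.+2] minus the distance to the top of fibre [j]. *)
Definition fibre_height j v : nat := leaf_height j v.1 + v.2.

Lemma fibre_height_lip j u v :
  adj u v -> fibre_height j v <= (fibre_height j u).+1.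
Proof.
rewrite /= /cart_adj /fibre_height => /orP[]/andP[/eqP->].
  rewrite /path_adj -addnS leq_add2l => /orP[]/eqP => [->|<-] //.
  by rewrite ltnW // ltnS leqnSn.
by move=> uv; rewrite -addSn leq_add2r leaf_height_lip.
Qed.

Lemma flat_shortest i j h : i != j ->
  @shortest_path G (Some i, h) (Some j, h)
    [:: (Some i, h); (None, h); (Some j, h)].
Proof.
move=> ij; apply: (shortest_path_lipschitz (@fibre_height_lip j)).
  by rewrite /= /cart_adj /= !inE !xpair_eqE /= !eqxx leaf_eq (negPf ij).
by rewrite /fibre_height /leaf_height /= eqxx leaf_eq (negPf ij) addnC.
Qed.

(* The geodesic from the bottom of fibre [i] to the top of fibre [j] that climbs
   in fibre [w]; [w] is meant to be [Some i], [None] or [Some j]. *)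
Definition climbing i j w : seq G :=
  if w == Some i then (w, ord0) :: climb w ++ [:: (None, ord_max); (Some j, ord_max)]
  else if w == None then
    (Some i, ord0) :: ((w, ord0) :: climb w) ++ [:: (Some j, ord_max)]
  else [:: (Some i, ord0), (None, ord0), (w, ord0) & climb w].

Lemma mem_climbing i j w v : v.1 = w -> v \in climbing i j w.
Proof.
move=> /eqP; rewrite -mem_climb /climbing => vw.
by do 2?case: ifP => _; rewrite ?inE ?mem_cat -?in_cons; move: vw;
  rewrite !inE ?mem_cat; do 3?case: (_ == _); rewrite ?orbT //= => ->; rewrite ?orbT.
Qed.

Lemma climbing_shortest i j w : i != j -> w \in [:: Some i; None; Some j] ->
  @shortest_path G (Some i, ord0) (Some j, ord_max) (climbing i j w).
Proof.
move=> ij w_ij; apply: (shortest_path_lipschitz (@fibre_height_lip j)); last first.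
  (* The climbed fibre contributes [l.+1] vertices, the other two fibres one each. *)
  have -> : size (climbing i j w) = l.+3.
    rewrite /climbing; do 2?case: ifP => _;
      by rewrite /= ?size_cat /= climb_size ?addn2 ?addn1.
  by rewrite /fibre_height /leaf_height /= eqxx leaf_eq (negPf ij).
have out w' v : v.1 != w' -> (v \in ((w', ord0) : G) :: climb w') = false.
  by rewrite mem_climb => /negPf.
have ji : j != i by rewrite eq_sym.
move: w_ij; rewrite !inE /climbing => /or3P[]/eqP->.
- rewrite eqxx /is_path eqxx cat_path climb_path last_cat climb_last.
  by rewrite -cat_cons cat_uniq climb_uniq /= /cart_adj /= !eqxx !out.
- rewrite /is_path /= eqxx cat_path climb_path last_cat climb_last.
  rewrite -!cons_uniq -!cat_cons cat_uniq cons_uniq climb_uniq out //.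
  rewrite has_seq1 in_cons out //.
  by rewrite !xpair_eqE !leaf_eq (negPf ji) /= /cart_adj /= ?eqxx.
- rewrite leaf_eq (negPf ji) /=.
  have /= -> := climb_path (Some j); have /= -> := climb_uniq (Some j).
  by rewrite climb_last in_cons !out ?eqxx ?leaf_eq.
Qed.

Definition fibre_end i : G := (Some i, if i < 2 then ord0 else ord_max).

(** For [i < 2 <= j], the test [j == i.+2] singles out the pairs (0,2) and (1,3). *)
Definition climbed i j : star k :=
  if j == i.+2 :> nat then Some i
  else if (i == 1 :> nat) && (3 < j) then None else Some j.

Lemma climbed_onto w : 4 < k ->
  exists i j, [/\ i < 2, 1 < j & climbed i j = w].
Proof.
move=> k5; pose o n (nk : n < 5) : 'I_k := Ordinal (leq_trans nk k5).
case: w => [[[|[|[|n]]] nk]|].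
- by exists (@o 0 isT), (@o 2 isT); split=> //; congr Some; apply: val_inj.
- by exists (@o 1 isT), (@o 3 isT); split=> //; congr Some; apply: val_inj.
- by exists (@o 1 isT), (@o 2 isT); split=> //; congr Some; apply: val_inj.
(* All leaves from 3 on are paired with leaf 0. *)
- by exists (@o 0 isT), (Ordinal nk).
by exists (@o 1 isT), (@o 4 isT).
Qed.

(** Increasing leaf index puts bottom ends before top ends, as [climbing] expects. *)
Definition leaf_lt : rel G := fun x y =>
  if (x.1, y.1) is (Some i, Some j) then i < j else false.

Definition geodesic (x y : G) : seq G :=
  if (x.1, y.1) is (Some i, Some j) then
    if i < 2 <= j then climbing i j (climbed i j)
    else [:: x; ((None, x.2) : G); y]
  else [::].

Lemma geodesic_shortest i j : i < j ->
  shortest_path (fibre_end i) (fibre_end j)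
    (geodesic (fibre_end i) (fibre_end j)).
Proof.
move=> lt_ij; have ij : i != j by apply: contraTneq lt_ij => ->; rewrite ltnn.
rewrite /geodesic /fibre_end /=; case: (ltnP i 2) => i2 /=.
  case: (ltnP j 2) => j2 /=; first exact: flat_shortest.
  apply: climbing_shortest => //; rewrite /climbed.
  by do 2?case: ifP => _; rewrite !inE eqxx ?orbT.
(* Both ends are now at the top level. *)
have /leq_gtF-> : 2 <= j by apply: leq_trans i2 (ltnW lt_ij).
exact: flat_shortest.
Qed.

Lemma starpath_strong_geodetic : 4 < k ->
  @strong_geodetic G [set fibre_end i | i : 'I_k].
Proof.
move=> k5; right.
exists (fun x y => if leaf_lt x y then geodesic x y else rev (geodesic y x)).
  apply: path_selection_rel => _ _ /imsetP[i _ ->] /imsetP[j _ ->].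
    rewrite /leaf_lt /= => ij; case: (ltngtP i j) => // /val_inj eij.
    by rewrite eij eqxx in ij.
  exact: geodesic_shortest.
move=> v; have [i [j [i2 j2 ij_v]]] := climbed_onto v.1 k5.
have ij : i < j by apply: leq_trans j2.
exists (fibre_end i), (fibre_end j); split; try by apply/imsetP; eexists.
  by apply: contraTneq ij => -[/(congr1 val)/= ->]; rewrite ltnn.
by rewrite /leaf_lt /= ij /geodesic /= i2 j2 mem_climbing.
Qed.

Lemma sg_starpath : 4 < k -> sg G = k.
Proof.
move=> k5; apply/eqP; rewrite eqn_leq; apply/andP; split.
  apply: leq_trans (sg_le (starpath_strong_geodetic k5)) _.
  by rewrite card_imset ?card_ord // => i j [].
by have [S /starpath_lower SS <-] := sg_attained G.
Qed.

End StarPath.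

Theorem proposition3p2 (k l : nat) (hk : 5 <= k) (hl : 1 <= l) :
  sg (cart_prod (star k) (path_graph l)) = sg (star k).
Proof.
(* A successor provides the ends [ord0] and [ord_max], which coincide for a one-vertex path. *)
case: l hl => // l _.
by rewrite sg_starpath // sg_star //; apply: leq_trans hk.
Qed.
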